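(* Let $0<d<\infty$ and let $u:\mathbb{R}^2\to\mathbb{R}$ be a periodic function with domain of periodicity $P_0$ satisfying $D_6$-symmetry, where $$P_0=\left\{(x_1,x_2)\in\mathbb{R}^2:\ \tfrac{x_1}{\sqrt3}-\tfrac{2}{\sqrt3}d\le x_2\le \tfrac{x_1}{\sqrt3}+\tfrac{2}{\sqrt3}d,\ -d\le x_1\le d\right\}.$$ Let $$P_1=\left\{\left(x_1-d,\ x_2+\tfrac{d}{\sqrt3}\right):(x_1,x_2)\in P_0\right\},\qquad P_2=\left\{R_{\frac{2\pi}{3}}x: x\in P_1\right\},\qquad P_3=\left\{R_{\frac{4\pi}{3}}x: x\in P_1\right\},$$ where $R_\theta$ is the rotation matrix by angle $\theta$, and let $H_0=P_1\cup P_2\cup P_3$ (a regular hexagonal domain). Then $u$ satisfies periodic boundary conditions on $H_0$.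
   Context: Let $\mathcal{L}=\begin{bmatrix}1&-\tfrac12\\0&\tfrac{\sqrt3}{2}\end{bmatrix}$ and let $\mathcal{L}^{-T}$ be the inverse of its transpose; then $P_0$ is the (closed) parallelogram $\mathcal{L}^{-T}[-d,d]^2$. A function $u:\mathbb{R}^2\to\mathbb{R}$ is periodic with domain of periodicity $P_0$ if $u(x+p)=u(x)$ for all $x\in\mathbb{R}^2$ and all $p\in 2d\,\mathcal{L}^{-T}\mathbb{Z}^2$, i.e. $u$ is invariant under translation by $(2d,\tfrac{2d}{\sqrt3})$ and by $(0,\tfrac{4d}{\sqrt3})$. $D_6$ denotes the dihedral group of order $12$, acting linearly on $\mathbb{R}^2$ as the group of orthogonal matrices generated by the rotation $R_{\pi/3}$ about the origin by angle $\pi/3$ and the reflection $\begin{bmatrix}1&0\\0&-1\end{bmatrix}$. The function $u$ satisfies $D_6$-symmetry if $u(gx)=u(x)$ for all $g\in D_6$ and $x\in\mathbb{R}^2$. A function $u:\mathbb{R}^2\to\mathbb{R}$ satisfies periodic boundary conditions on a regular hexagon $H$ (equivalently, $u$ is periodic on $H$, so that its periodic pattern is generated by the tiling of the plane by translated copies of $H$) if $u(x+t)=u(x)$ for all $x\in\mathbb{R}^2$ and for every translation vector $t$ that carries a side of $H$ onto the opposite side of $H$. *)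

(* Defs.v *)
From mathcomp Require Import all_boot all_order all_algebra.
From mathcomp Require Import all_classical all_reals all_analysis.
From mathcomp Require Import ring lra.

Set Implicit Arguments.
Unset Strict Implicit.
Unset Printing Implicit Defensive.
Import Order.TTheory GRing.Theory Num.Theory.

Local Open Scope classical_set_scope.
Local Open Scope ring_scope.

Section Definitions.
Variable R : realType.

Definition vec2 (a b : R) : 'cV[R]_2 := \col_i (if i == 0 then a else b).

Definition mat2 (a b c e : R) : 'M[R]_2 :=
  \matrix_(i, j) (if i == 0 then if j == 0 then a else b
                  else if j == 0 then c else e).

Definition sqrt3 : R := Num.sqrt 3.

Definition rotation (theta : R) : 'M[R]_2 :=
  mat2 (cos theta) (- sin theta) (sin theta) (cos theta).

Definition lattice_mx : 'M[R]_2 := mat2 1 (- (1 / 2)) 0 (sqrt3 / 2).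

Definition P0 (d : R) : set 'cV[R]_2 :=
  [set x | [/\ x 0 0 / sqrt3 - 2 / sqrt3 * d <= x 1 0,
               x 1 0 <= x 0 0 / sqrt3 + 2 / sqrt3 * d
             & - d <= x 0 0 <= d]].

Lemma sqrt3_gt0 : 0 < sqrt3.
Proof. by rewrite sqrtr_gt0. Qed.

Lemma sqrt3_sqr : sqrt3 * sqrt3 = 3.
Proof. by rewrite -expr2 sqr_sqrtr. Qed.

Lemma invmx_lattice :
  invmx lattice_mx^T = mat2 1 0 (1 / sqrt3) (2 / sqrt3).
Proof.
have s0 : sqrt3 != 0 by rewrite gt_eqF ?sqrt3_gt0.
have E : lattice_mx^T *m mat2 1 0 (1 / sqrt3) (2 / sqrt3) = 1%:M.
  apply/matrixP => i j; rewrite !mxE !big_ord_recl big_ord0 !mxE /=.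
  by case: i => [[|[|i]] ?] //; case: j => [[|[|j]] ?] //=; field.
have [U _] := mulmx1_unit E.
by rewrite -[RHS](mulKmx U) E mulmx1.
Qed.

Lemma P0E (d : R) :
  P0 d = [set invmx lattice_mx^T *m y |
           y in [set y : 'cV[R]_2 | forall i, - d <= y i 0 <= d]].
Proof.
have s0 : sqrt3 != 0 by rewrite gt_eqF ?sqrt3_gt0.
have r0 : 0 < 2 / sqrt3 by rewrite divr_gt0 ?sqrt3_gt0.
rewrite invmx_lattice; apply/seteqP; split => [x [h1 h2 h3]|x [y hy <-]].
  exists (vec2 (x 0 0) ((x 1 0 - x 0 0 / sqrt3) / (2 / sqrt3))).
    move=> i; rewrite mxE; case: ifP => // _.
    by rewrite ler_pdivrMr // ler_pdivlMr //; apply/andP; split; lra.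
  apply/matrixP => i j; rewrite !mxE !big_ord_recl big_ord0 !mxE /= (ord1 j).
  case: i => [[|[|i]] Hi] //=.
    rewrite mul1r mul0r !addr0; congr (x _ _); exact: val_inj.
  have -> : Ordinal Hi = 1 by apply: val_inj.
  by field.
have := hy 0; have := hy 1 => /andP[a1 a2] b.
have E0 : (mat2 1 0 (1 / sqrt3) (2 / sqrt3) *m y) 0 0 = y 0 0.
  by rewrite !mxE !big_ord_recl big_ord0 !mxE /= mul1r mul0r !addr0.
have E1 : (mat2 1 0 (1 / sqrt3) (2 / sqrt3) *m y) 1 0
        = y 0 0 / sqrt3 + 2 / sqrt3 * y 1 0.
  rewrite !mxE !big_ord_recl big_ord0 !mxE /= addr0 mul1r mulrC.
  by congr (_ + _ * y _ _); apply: val_inj.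
rewrite /P0 /= E0 E1; split => //; last by rewrite lerD2l ler_pM2l.
rewrite lerD2l -mulrN ler_pM2l //.
Qed.

Definition P0_periodic (d : R) (u : 'cV[R]_2 -> R) : Prop :=
  forall (k : 'cV[int]_2) (x : 'cV[R]_2),
    u (x + (2 * d) *: (invmx lattice_mx^T *m map_mx intr k)) = u x.

Inductive D6 : 'M[R]_2 -> Prop :=
| D6_one : D6 1%:M
| D6_rot : D6 (rotation (pi / 3))
| D6_refl : D6 (mat2 1 0 0 (- 1))
| D6_mul g h : D6 g -> D6 h -> D6 (g *m h)
| D6_inv g : D6 g -> D6 (invmx g).

Definition D6_symmetric (u : 'cV[R]_2 -> R) : Prop :=
  forall (g : 'M[R]_2) (x : 'cV[R]_2), D6 g -> u (g *m x) = u x.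

Definition P1 (d : R) : set 'cV[R]_2 :=
  [set vec2 (x 0 0 - d) (x 1 0 + d / sqrt3) | x in P0 d].

Definition P2 (d : R) : set 'cV[R]_2 :=
  [set rotation (2 * pi / 3) *m x | x in P1 d].

Definition P3 (d : R) : set 'cV[R]_2 :=
  [set rotation (4 * pi / 3) *m x | x in P1 d].

Definition H0 (d : R) : set 'cV[R]_2 := P1 d `|` P2 d `|` P3 d.

Definition convex_hull (A : set 'cV[R]_2) : set 'cV[R]_2 :=
  smallest (@convex_set R 'cV[R]_2) A.

(* Vertices are numbered counterclockwise, with indices read modulo 6: the
   k-th vertex of the hexagon with center c and 0-th vertex c + v. *)
Definition hex_vertex (c v : 'cV[R]_2) (k : nat) : 'cV[R]_2 :=
  c + rotation (k%:R * pi / 3) *m v.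

Definition hex_side (c v : 'cV[R]_2) (k : nat) : set 'cV[R]_2 :=
  convex_hull [set hex_vertex c v k; hex_vertex c v k.+1].

Definition hexagon (c v : 'cV[R]_2) : set 'cV[R]_2 :=
  convex_hull [set hex_vertex c v k | k in `I_6].

Definition regular_hexagon (H : set 'cV[R]_2) : Prop :=
  exists c v : 'cV[R]_2, v != 0 /\ H = hexagon c v.

Definition opposite_sides (H S S' : set 'cV[R]_2) : Prop :=
  exists (c v : 'cV[R]_2) (k : nat),
    [/\ v != 0, H = hexagon c v, S = hex_side c v k
      & S' = hex_side c v (k + 3)].

(* This is vacuous when H is not a regular hexagon. *)
Definition hexagon_periodic (H : set 'cV[R]_2) (u : 'cV[R]_2 -> R) : Prop :=
  forall (S S' : set 'cV[R]_2) (t : 'cV[R]_2),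
    opposite_sides H S S' -> [set x + t | x in S] = S' ->
    forall x : 'cV[R]_2, u (x + t) = u x.

End Definitions.

(* Main.v *)
Require Import Defs.
From mathcomp Require Import all_boot all_order all_algebra.
From mathcomp Require Import all_classical all_reals all_analysis.
From mathcomp Require Import ring lra.

(** H0 is the regular hexagon centred at 0 whose vertices are the six shortest
    nonzero vectors of the period lattice.  Suppose that H0 is also the hexagon
    with center c and vertices c + w_k.  The points ±V, for V a vertex of H0,
    lie in the disc of radius |w_k| around c, and the points c ± w_k lie in the
    disc of radius |V| around 0; the parallelogram law then forces c = 0 and
    |w_k| = |V|.  A point of H0 as far from 0 as a vertex is a vertex, so w_k is
    a lattice vector.  A translation carrying a side onto the opposite one is
    - (w_k + w_(k+1)), hence a period of u. *)

Set Implicit Arguments.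
Unset Strict Implicit.
Unset Printing Implicit Defensive.
Import Order.TTheory GRing.Theory Num.Theory.
Local Open Scope ring_scope.
Local Open Scope classical_set_scope.

(** * The plane in coordinates, with the squared Euclidean norm *)

Section Coordinates.
Variable R : realType.
Implicit Types (x y : 'cV[R]_2) (a b c e : R).

Lemma vec2_0 a b : vec2 a b 0 0 = a. Proof. by rewrite mxE. Qed.

Lemma vec2_1 a b : vec2 a b 1 0 = b. Proof. by rewrite mxE. Qed.

Lemma cV2_eq x y : x 0 0 = y 0 0 -> x 1 0 = y 1 0 -> x = y.
Proof.
move=> e0 e1; apply/matrixP => i j; rewrite (ord1 j).
case: i => [[|[|i]] Hi] //; [move: e0|move: e1].
  by rewrite (_ : Ordinal Hi = 0) //; apply: val_inj.
by rewrite (_ : Ordinal Hi = 1) //; apply: val_inj.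
Qed.

Lemma mat2_mulE a b c e x :
  mat2 a b c e *m x = vec2 (a * x 0 0 + b * x 1 0) (c * x 0 0 + e * x 1 0).
Proof.
by apply: cV2_eq; rewrite !mxE !big_ord_recl big_ord0 !mxE /= addr0;
  congr (_ + _ * x _ _); apply: val_inj.
Qed.

Definition coordE := (mat2_mulE, vec2_0, vec2_1).

Definition sqnorm x : R := x 0 0 ^+ 2 + x 1 0 ^+ 2.

End Coordinates.

(** * Rotations by multiples of [pi / 3] and the vertices they generate *)

Section Rotations.
Variable R : realType.
Implicit Types (x v : 'cV[R]_2) (a b : R).
Local Notation s := (sqrt3 R).

(** With C = cos(pi/3), the triple-angle formula and cos(pi) = -1 give 4C^3 - 3C + 1 = (C + 1)(2C -
    1)^2 = 0, and C > 0 excludes C = -1. *)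
Lemma cos_pi3 : cos (pi / 3 : R) = 1 / 2.
Proof.
have p0 := pi_gt0 R.
have c0 : 0 < cos (pi / 3 : R).
  by apply: cos_gt0_pihalf; apply/andP; split; lra.
have : cos (pi / 3 + pi / 3 + pi / 3 : R) = -1.
  by rewrite (_ : _ + _ = pi) ?cospi //; field.
rewrite cosD cosD sinD.
have := cos2Dsin2 (pi / 3 : R).
move: (cos _) (sin _) c0 => C S C0 e1 e3.
have S2 : S ^+ 2 = 1 - C ^+ 2 by rewrite -e1; ring.
have : (C + 1) * (2 * C - 1) ^+ 2 = 0.
  have -> : (C + 1) * (2 * C - 1) ^+ 2 =
    (C * C - S * S) * C - (S * C + C * S) * S + 1 + 3 * C * (S ^+ 2 - (1 - C ^+ 2)).
    by ring.
  by rewrite e3 S2; ring.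
move/eqP; rewrite mulf_eq0 expf_eq0 /= => /orP[] /eqP; lra.
Qed.

Lemma sin_pi3 : sin (pi / 3 : R) = s / 2.
Proof.
have p0 := pi_gt0 R; have s0 := sqrt3_gt0 R; have s2 := sqrt3_sqr R.
have S0 : 0 < sin (pi / 3 : R) by apply: sin_gt0_pi; apply/andP; split; lra.
have := cos2Dsin2 (pi / 3 : R); rewrite cos_pi3.
move: (sin _) S0 => S S0 e.
have : (S - s / 2) * (S + s / 2) = 0.
  by rewrite (_ : _ * _ = S ^+ 2 - s * s / 4); [rewrite s2; lra|field].
by move/eqP; rewrite mulf_eq0 => /orP[] /eqP; lra.
Qed.

Lemma rotationD a b x :
  rotation (a + b) *m x = rotation a *m (rotation b *m x).
Proof. by rewrite /rotation !coordE cosD sinD; apply: cV2_eq; rewrite !coordE; ring. Qed.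

Lemma rotation0 x : rotation 0 *m x = x.
Proof. by rewrite /rotation cos0 sin0; apply: cV2_eq; rewrite !coordE; ring. Qed.

Lemma rotation_pi3E x : rotation (pi / 3) *m x =
  vec2 (x 0 0 / 2 - s * x 1 0 / 2) (s * x 0 0 / 2 + x 1 0 / 2).
Proof.
by rewrite /rotation cos_pi3 sin_pi3; apply: cV2_eq; rewrite !coordE; field.
Qed.

Lemma rotation_2pi3E x : rotation (2 * pi / 3) *m x =
  vec2 (- x 0 0 / 2 - s * x 1 0 / 2) (s * x 0 0 / 2 - x 1 0 / 2).
Proof.
have s2 := sqrt3_sqr R.
rewrite (_ : 2 * pi / 3 = pi / 3 + pi / 3); last by field.
rewrite rotationD !rotation_pi3E !coordE; apply: cV2_eq; rewrite !coordE.
  rewrite (_ : s * (_ + _) / 2 = s * s * x 0 0 / 4 + s * x 1 0 / 4); last by field.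
  by rewrite s2; field.
rewrite (_ : s * (_ - _) / 2 = s * x 0 0 / 4 - s * s * x 1 0 / 4); last by field.
by rewrite s2; field.
Qed.

Lemma rotation_4pi3E x : rotation (4 * pi / 3) *m x =
  vec2 (- x 0 0 / 2 + s * x 1 0 / 2) (- s * x 0 0 / 2 - x 1 0 / 2).
Proof.
rewrite (_ : 4 * pi / 3 = pi / 3 + pi); last by field.
rewrite /rotation cosDpi sinDpi cos_pi3 sin_pi3.
by apply: cV2_eq; rewrite !coordE; field.
Qed.

Lemma rotation_2pi3K x :
  rotation (4 * pi / 3) *m (rotation (2 * pi / 3) *m x) = x.
Proof.
rewrite -rotationD (_ : _ + _ = 0 + pi + pi); last by field.
by rewrite /rotation !(cosDpi, sinDpi) !opprK; exact: rotation0.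
Qed.

Lemma rotation_4pi3K x :
  rotation (2 * pi / 3) *m (rotation (4 * pi / 3) *m x) = x.
Proof. by rewrite -rotationD addrC rotationD rotation_2pi3K. Qed.

Lemma sqnorm_rotation a x : sqnorm (rotation a *m x) = sqnorm x.
Proof.
rewrite /sqnorm /rotation !coordE.
have -> : (cos a * x 0 0 + - sin a * x 1 0) ^+ 2 +
   (sin a * x 0 0 + cos a * x 1 0) ^+ 2 =
   (cos a ^+ 2 + sin a ^+ 2) * (x 0 0 ^+ 2 + x 1 0 ^+ 2) by ring.
by rewrite cos2Dsin2 mul1r.
Qed.

Lemma hex_vertex0 v : hex_vertex 0 v 0 = v.
Proof. by rewrite /hex_vertex !mul0r rotation0 add0r. Qed.

Lemma hex_vertexS v k :
  hex_vertex 0 v k.+1 = rotation (pi / 3) *m hex_vertex 0 v k.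
Proof.
rewrite /hex_vertex !add0r -rotationD; congr (rotation _ *m _).
by rewrite -natr1; field.
Qed.

Lemma hex_vertexD3 v k : hex_vertex 0 v (k + 3) = - hex_vertex 0 v k.
Proof.
rewrite /hex_vertex !add0r.
rewrite (_ : (k + 3)%:R * pi / 3 = k%:R * pi / 3 + pi); last by rewrite natrD; field.
rewrite /rotation cosDpi sinDpi; apply: cV2_eq; rewrite !coordE !mxE /= ?mxE; ring.
Qed.

Lemma hex_vertex_center (c : 'cV[R]_2) v k :
  hex_vertex c v k = c + hex_vertex 0 v k.
Proof. by rewrite /hex_vertex add0r. Qed.

(** Two half turns cancel. Hence every natural index is usable, although [hexagon] lists only k <
    6. *)
Lemma hex_vertex_modn v k : hex_vertex 0 v (k %% 6) = hex_vertex 0 v k.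
Proof.
rewrite [in RHS](divn_eq k 6) addnC; elim: (k %/ 6)%N => [|n IH].
  by rewrite addn0.
by rewrite mulSnr addnA (_ : 6 = 3 + 3)%N // !addnA !hex_vertexD3 opprK.
Qed.

Lemma sqnorm_hex_vertex v k : sqnorm (hex_vertex 0 v k) = sqnorm v.
Proof. by rewrite /hex_vertex add0r sqnorm_rotation. Qed.

End Rotations.

(** * Convex hulls: rhombi inside a hexagon, the disc around it, segments *)

Section ConvexHulls.
Variable R : realType.
Implicit Types (x y c v w : 'cV[R]_2) (a b r : R) (A : set 'cV[R]_2).

Lemma convex_setP A : @convex_set R 'cV[R]_2 A <->
  (forall x y a, 0 <= a -> a <= 1 -> A x -> A y -> A (a *: x + (1 - a) *: y)).
Proof.
split=> [cA x y a a0 a1 Ax Ay|cA x y l].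
  by move/mem_set: Ay; move/mem_set: Ax => /cA /[apply] /(_ (Itv01 a0 a1)) /set_mem.
by move=> /set_mem Ax /set_mem Ay; apply/mem_set/cA.
Qed.

Lemma convex_convex_hull A : @convex_set R 'cV[R]_2 (convex_hull A).
Proof.
apply/convex_setP => x y a a0 a1 hx hy M [/= cM AM].
by move/convex_setP: (cM); apply => //; [apply: hx|apply: hy].
Qed.

Lemma convex_hull_sub A M :
  (forall x y a, 0 <= a -> a <= 1 -> M x -> M y -> M (a *: x + (1 - a) *: y)) ->
  A `<=` M -> convex_hull A `<=` M.
Proof. by move=> /convex_setP cM AM; apply: smallest_sub. Qed.

Lemma sub_convex_hull A : A `<=` convex_hull A.
Proof. exact: sub_gen_smallest. Qed.

(** Interpolate with weight b from x to x + y and from 0 to y, then with weight a between the two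
    points obtained. *)
Lemma convex_parallelogram A x y a b : @convex_set R 'cV[R]_2 A ->
  A 0 -> A x -> A y -> A (x + y) -> 0 <= a <= 1 -> 0 <= b <= 1 ->
  A (a *: x + b *: y).
Proof.
move=> /convex_setP cA A0 Ax Ay Axy /andP[a0 a1] /andP[b0 b1].
have -> : a *: x + b *: y =
    a *: (b *: (x + y) + (1 - b) *: x) + (1 - a) *: (b *: y + (1 - b) *: 0).
  by apply: cV2_eq; rewrite !mxE; ring.
by apply: (cA) => //; apply: cA.
Qed.

Lemma hexagon_vertex c v k : hexagon c v (hex_vertex c v k).
Proof.
rewrite hex_vertex_center -hex_vertex_modn -hex_vertex_center.
by apply: sub_convex_hull; exists (k %% 6)%N => //=; rewrite ltn_mod.
Qed.

Lemma hexagon_center v : hexagon 0 v 0.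
Proof.
have /convex_setP cH := @convex_convex_hull [set hex_vertex 0 v k | k in `I_6].
have e : 0 = 2^-1 *: hex_vertex 0 v 0 + (1 - 2^-1) *: hex_vertex 0 v 3.
  by rewrite (hex_vertexD3 v 0); apply: cV2_eq; rewrite !mxE; field.
have h0 : 0 <= 2^-1 :> R by lra.
have h1 : 2^-1 <= 1 :> R by lra.
have := cH _ _ _ h0 h1 (@hexagon_vertex 0 v 0) (@hexagon_vertex 0 v 3).
by rewrite -e.
Qed.

(** The rotation r by pi/3 acts as a primitive sixth root of unity, so 1 + r^2 = r. *)
Lemma hex_vertexSS v k :
  hex_vertex 0 v k + hex_vertex 0 v k.+2 = hex_vertex 0 v k.+1.
Proof.
have s2 := sqrt3_sqr R.
rewrite !hex_vertexS; set w := hex_vertex 0 v k.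
rewrite -rotationD (_ : pi / 3 + pi / 3 = 2 * pi / 3); last by field.
rewrite rotation_pi3E rotation_2pi3E.
by apply: cV2_eq; rewrite mxE !coordE; field.
Qed.

(** The corner of this rhombus opposite to 0 is vertex k + 1, by [hex_vertexSS]. For k = 1, 3, 5 and
    v = [H0_vertex], these rhombi are the pieces [P1], [P2], [P3]. *)
Lemma hexagon_rhombus v k a b : 0 <= a <= 1 -> 0 <= b <= 1 ->
  hexagon 0 v (a *: hex_vertex 0 v k + b *: hex_vertex 0 v k.+2).
Proof.
move=> ha hb; apply: convex_parallelogram => //.
- exact: convex_convex_hull.
- exact: hexagon_center.
- exact: hexagon_vertex.
- exact: hexagon_vertex.
- by rewrite hex_vertexSS; apply: hexagon_vertex.
Qed.

Lemma hexagon_sub_disc c v x : hexagon c v x -> sqnorm (x - c) <= sqnorm v.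
Proof.
move: x; apply: convex_hull_sub => [x y a a0 a1|_ [k _ <-]].
  rewrite /sqnorm !mxE.
  set x0 := x 0 0; set x1 := x 1 0; set y0 := y 0 0; set y1 := y 1 0.
  set c0 := c 0 0; set c1 := c 1 0.
  move: (v 0 0 ^+ 2 + _) => M hx hy.
  have {hx hy} h : a * ((x0 - c0) ^+ 2 + (x1 - c1) ^+ 2) +
     (1 - a) * ((y0 - c0) ^+ 2 + (y1 - c1) ^+ 2) <= a * M + (1 - a) * M.
    by apply: lerD; apply: ler_wpM2l => //; rewrite subr_ge0.
  (* This is the exact defect a|x - c|^2 + (1 - a)|y - c|^2 - |ax + (1 - a)y - c|^2. *)
  have q : 0 <= a * (1 - a) * ((x0 - y0) ^+ 2 + (x1 - y1) ^+ 2).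
    by rewrite !mulr_ge0 ?subr_ge0 // addr_ge0 ?sqr_ge0.
  by move: h q; nra.
by rewrite hex_vertex_center addrC addKr sqnorm_hex_vertex.
Qed.

Lemma segment_point x y z :
  convex_hull [set x; y] z -> exists2 a, 0 <= a <= 1 & z = x + a *: (y - x).
Proof.
move: z; apply: convex_hull_sub => [p q a a0 a1 [b b01 ->] [e e01 ->]|_ [->|->]].
- exists (a * b + (1 - a) * e); last by apply: cV2_eq; rewrite !mxE; ring.
  by move: b01 e01 => /andP[? ?] /andP[? ?]; apply/andP; split; nra.
- by exists 0; rewrite ?lexx ?ler01 // scale0r addr0.
- by exists 1; rewrite ?lexx ?ler01 // scale1r addrCA subrr addr0.
Qed.

End ConvexHulls.

(** * [H0] as an intersection of strips and as a regular hexagon; its vertices *)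

Section Hexagon.
Variables (R : realType) (d : R).
Implicit Types (x c v w : 'cV[R]_2).
Local Notation s := (sqrt3 R).

Let s_gt0 : 0 < s := sqrt3_gt0 R.
Let s_neq0 : s != 0. Proof. by rewrite gt_eqF. Qed.
Let ssqr : s * s = 3 := sqrt3_sqr R.

Definition H0_vertex : 'cV[R]_2 := vec2 (2 * d) (2 * d / s).

(** Scaling by [sqrt3] makes the bounds linear in the two quantities x_1 and sqrt3 x_2, the form
    that [lra] handles in all that follows. *)
Lemma P1E x : P1 d x <-> - (2 * d) <= x 0 0 <= 0 /\ 0 <= s * x 1 0 - x 0 0 <= 4 * d.
Proof.
have sK a : s * (a / s) = a by field.
split=> [[y [h1 h2 h3] <-]|[h1 h2]].
  have := ler_wpM2l (ltW s_gt0) h1; have := ler_wpM2l (ltW s_gt0) h2.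
  rewrite !coordE !mulrDr mulrN !(mulrAC _ s^-1) !sK => *.
  by split; lra.
exists (vec2 (x 0 0 + d) (x 1 0 - d / s)); last first.
  by apply: cV2_eq; rewrite !coordE; ring.
split; rewrite !coordE; [rewrite -(ler_pM2l s_gt0)|rewrite -(ler_pM2l s_gt0)|lra].
  by rewrite !mulrBr (mulrAC _ s^-1) !sK; lra.
by rewrite mulrBr mulrDr (mulrAC _ s^-1) !sK; lra.
Qed.

(** The point is pulled back to [P1] by the inverse rotation, by 4 pi/3. *)
Lemma P2E x : P2 d x <->
  0 <= x 0 0 - s * x 1 0 <= 4 * d /\ 0 <= - x 0 0 - s * x 1 0 <= 4 * d.
Proof.
have -> : P2 d x <-> P1 d (rotation (4 * pi / 3) *m x).
  by split=> [[y hy <-]|h]; [rewrite rotation_2pi3K|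
    exists (rotation (4 * pi / 3) *m x); rewrite ?rotation_4pi3K].
rewrite P1E rotation_4pi3E !coordE.
have -> : s * (- s * x 0 0 / 2 - x 1 0 / 2) = - (s * s) * x 0 0 / 2 - s * x 1 0 / 2.
  by field.
by rewrite ssqr; split=> -[? ?]; split; lra.
Qed.

Lemma P3E x : P3 d x <->
  0 <= x 0 0 <= 2 * d /\ 0 <= x 0 0 + s * x 1 0 <= 4 * d.
Proof.
have -> : P3 d x <-> P1 d (rotation (2 * pi / 3) *m x).
  by split=> [[y hy <-]|h]; [rewrite rotation_4pi3K|
    exists (rotation (2 * pi / 3) *m x); rewrite ?rotation_2pi3K].
rewrite P1E rotation_2pi3E !coordE.
have -> : s * (s * x 0 0 / 2 - x 1 0 / 2) = (s * s) * x 0 0 / 2 - s * x 1 0 / 2.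
  by field.
by rewrite ssqr; split=> -[? ?]; split; lra.
Qed.

Lemma H0E x : H0 d x <->
  [/\ - (2 * d) <= x 0 0 <= 2 * d,
      - (4 * d) <= x 0 0 + s * x 1 0 <= 4 * d
    & - (4 * d) <= x 0 0 - s * x 1 0 <= 4 * d].
Proof.
split=> [[[/P1E[? ?]|/P2E[? ?]]|/P3E[? ?]]|[? ? ?]]; try by split; lra.
(* The three diagonals cut the plane into six sectors, and each rhombus fills two adjacent ones. Two
   of the eight sign patterns are contradictory. *)
have [x0|x0] := lerP (x 0 0) 0; have [y0|y0] := lerP (x 0 0 - s * x 1 0) 0;
  have [z0|z0] := lerP (x 0 0 + s * x 1 0) 0.
- by left; left; apply/P1E; split; lra.
- by left; left; apply/P1E; split; lra.
- by left; right; apply/P2E; split; lra.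
- by left; right; apply/P2E; split; lra.
- by right; apply/P3E; split; lra.
- by right; apply/P3E; split; lra.
- by left; right; apply/P2E; split; lra.
- by right; apply/P3E; split; lra.
Qed.

(** Dividing the bounded quantities of [P1E], [P2E], [P3E] by their ranges gives the rhombus
    coefficients. Conversely, the strips of [H0E] are convex and contain the six vertices. *)
Lemma H0_hexagon (d_gt0 : 0 < d) : H0 d = hexagon 0 H0_vertex.
Proof.
have V1 : hex_vertex 0 H0_vertex 1 = vec2 0 (4 * d / s).
  rewrite hex_vertexS hex_vertex0 rotation_pi3E /H0_vertex !coordE.
  apply: cV2_eq; rewrite !coordE; first by field.
  have -> : 4 * d / s = (1 + s * s) * d / s by rewrite ssqr; field.
  by field.
have V2 : hex_vertex 0 H0_vertex 2 = vec2 (- (2 * d)) (2 * d / s).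
  by apply: (addrI (H0_vertex)); rewrite -{1}(hex_vertex0 H0_vertex) hex_vertexSS V1;
    rewrite /H0_vertex; apply: cV2_eq; rewrite !mxE /=; field.
have V3 := hex_vertexD3 H0_vertex 0; rewrite hex_vertex0 add0n in V3.
have V4 := hex_vertexD3 H0_vertex 1; rewrite V1 in V4.
have V5 := hex_vertexD3 H0_vertex 2; rewrite V2 in V5.
(* Index 7 is vertex 1 again; the rhombus with k = 5 needs it as k + 2. *)
have V7 := hex_vertexD3 H0_vertex 4; rewrite V4 in V7.
have bnd (a b : R) : 0 < b -> 0 <= a <= b -> 0 <= a / b <= 1.
  move=> b0 /andP[a0 ab]; apply/andP; split; first by rewrite divr_ge0 ?(ltW b0).
  by rewrite ler_pdivrMr // mul1r.
have d4 : 0 < 4 * d by rewrite mulr_gt0.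
have d2 : 0 < 2 * d by rewrite mulr_gt0.
have d0 : d != 0 by rewrite gt_eqF.
apply/seteqP; split=> x.
  move=> [[/P1E[h1 h2]|/P2E[h1 h2]]|/P3E[h1 h2]].
  - have h : 0 <= - x 0 0 <= 2 * d by lra.
    have := @hexagon_rhombus R H0_vertex 1 _ _ (bnd _ _ d4 h2) (bnd _ _ d2 h).
    congr (hexagon _ _ _); rewrite V1 V3 /H0_vertex.
    by apply: cV2_eq; rewrite !mxE /=; field; rewrite ?d0 ?s_neq0.
  - have := @hexagon_rhombus R H0_vertex 3 _ _ (bnd _ _ d4 h2) (bnd _ _ d4 h1).
    congr (hexagon _ _ _); rewrite V3 V5 /H0_vertex.
    by apply: cV2_eq; rewrite !mxE /=; field; rewrite ?d0 ?s_neq0.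
  - have := @hexagon_rhombus R H0_vertex 5 _ _ (bnd _ _ d2 h1) (bnd _ _ d4 h2).
    congr (hexagon _ _ _); rewrite V5 V7 /H0_vertex.
    by apply: cV2_eq; rewrite !mxE /=; field; rewrite ?d0 ?s_neq0.
move: x; apply: convex_hull_sub => [x y a a0 a1 /H0E[p1 p2 p3] /H0E[q1 q2 q3]|_ [k k6 <-]].
  have cvx m (p q : R) : - m <= p <= m -> - m <= q <= m ->
      - m <= a * p + (1 - a) * q <= m.
    move=> /andP[? ?] /andP[? ?]; have ? : 0 <= 1 - a by lra.
    by apply/andP; split; nra.
  have := cvx _ _ _ p1 q1; have := cvx _ _ _ p2 q2; have := cvx _ _ _ p3 q3.
  by rewrite H0E !mxE => *; split; lra.
have sd a : s * (a * d / s) = a * d by field.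
case: k k6 => [|[|[|[|[|[|k]]]]]] //= _;
  rewrite ?hex_vertex0 ?V1 ?V2 ?V3 ?V4 ?V5 H0E /H0_vertex ?mxE /= ?mxE /=
    ?mulr0 ?mulrN ?sd ?mulr0; split; lra.
Qed.

Definition lattice_vector (k : 'cV[int]_2) : 'cV[R]_2 :=
  (2 * d) *: (invmx (lattice_mx R)^T *m map_mx intr k).

(* With A = |x_1| and S = sqrt3 |x_2|, points of H0 satisfy
   3A^2 + S^2 <= 3A^2 + (4d - A)^2 = 16d^2 - 4A(2d - A) <= 16d^2. *)
Lemma H0_sqnorm x : H0 d x -> sqnorm x <= 16 * d ^+ 2 / 3 /\
  (16 * d ^+ 2 / 3 <= sqnorm x -> exists k, x = lattice_vector k).
Proof.
move=> /H0E[h1 h2 h3].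
set A := `|x 0 0|; set S := `|s * x 1 0|.
have A2 : x 0 0 ^+ 2 = A ^+ 2 by rewrite real_normK ?num_real.
have S2 : x 1 0 ^+ 2 = S ^+ 2 / 3.
  by rewrite real_normK ?num_real // exprMn (expr2 s) ssqr; field.
have hA : A <= 2 * d by rewrite ler_norml; lra.
have hS : S <= 4 * d - A.
  rewrite /S /A; have [] := ger0P (x 0 0); have [] := ger0P (s * x 1 0); lra.
have A0 : 0 <= A := normr_ge0 _.
have S0 : 0 <= S := normr_ge0 _.
have SS : S ^+ 2 <= (4 * d - A) ^+ 2 by rewrite ler_sqr // nnegrE; lra.
have E : 3 * A ^+ 2 + (4 * d - A) ^+ 2 = 16 * d ^+ 2 - 4 * (A * (2 * d - A)) by ring.
have AA : 0 <= A * (2 * d - A) by rewrite mulr_ge0 // subr_ge0.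
rewrite /sqnorm A2 S2; split=> [|ge]; first by lra.
have /eqP : A * (2 * d - A) = 0 by lra.
have SE : S = 4 * d - A.
  apply/eqP; rewrite -(eqrXn2 (n := 2)) //; last by lra.
  by apply/eqP; lra.
(* The pair (m, n) yields the vector (2dm, 2d(m + 2n)/sqrt3). Equality leaves (A, S) = (0, 4d) or
   (2d, 2d), and the signs select (m, n) among ±(0, 1), ±(1, 0), ±(1, -1). *)
have lat (m n : int) : x 0 0 = 2 * d * m%:~R ->
    s * x 1 0 = 2 * d * (m%:~R + 2 * n%:~R) -> exists k, x = lattice_vector k.
  move=> e0 e1; exists (\col_i (if i == 0 then m else n)).
  rewrite /lattice_vector invmx_lattice mat2_mulE.
  apply: cV2_eq; rewrite !mxE /=; first by rewrite e0; ring.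
  by apply: (mulfI s_neq0); rewrite e1; field.
rewrite mulf_eq0 => /orP[/eqP Az|/eqP Az].
  have x0 : x 0 0 = 0 by apply/eqP; rewrite -normr_eq0 -/A Az.
  move: SE; rewrite /S Az; case: ger0P => _ e.
    by apply: (lat 0 1); lra.
  by apply: (lat 0 (-1)); lra.
have Ad : A = 2 * d by lra.
move: SE; rewrite Ad /S; move: Ad; rewrite /A.
case: ger0P => _ a; case: ger0P => _ e.
- by apply: (lat 1 0); lra.
- by apply: (lat 1 (-1)); lra.
- by apply: (lat (-1) 1); lra.
- by apply: (lat (-1) 0); lra.
Qed.

(** [opposite_sides] accepts any center and initial vertex describing the set, so every such
    description must be shown to have lattice vectors as its vertices relative to c. *)
Lemma hexagon_H0_vertex c v k : 0 < d -> H0 d = hexagon c v ->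
  exists l, hex_vertex 0 v k = lattice_vector l.
Proof.
move=> d_gt0 e; set w := hex_vertex 0 v k.
have qw : sqnorm w = sqnorm v by exact: sqnorm_hex_vertex.
have inH x : hexagon c v x -> sqnorm x <= 16 * d ^+ 2 / 3.
  by rewrite -e => /H0_sqnorm[].
have cw1 : sqnorm (c + w) <= 16 * d ^+ 2 / 3.
  by apply: inH; rewrite -hex_vertex_center; exact: hexagon_vertex.
have cw2 : sqnorm (c - w) <= 16 * d ^+ 2 / 3.
  by apply: inH; rewrite -hex_vertexD3 -hex_vertex_center; exact: hexagon_vertex.
pose V := H0_vertex.
have qV : sqnorm V = 16 * d ^+ 2 / 3.
  rewrite /sqnorm /V /H0_vertex !coordE.
  rewrite (_ : (2 * d / s) ^+ 2 = 4 * d ^+ 2 / (s * s)); last by field.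
  by rewrite ssqr; field.
have Vc1 : sqnorm (V - c) <= sqnorm v.
  apply: hexagon_sub_disc; rewrite -e (H0_hexagon d_gt0).
  by rewrite -[V]hex_vertex0; exact: hexagon_vertex.
have Vc2 : sqnorm (- V - c) <= sqnorm v.
  apply: hexagon_sub_disc; rewrite -e (H0_hexagon d_gt0).
  by rewrite -[V]hex_vertex0 -hex_vertexD3; exact: hexagon_vertex.
have par x y : sqnorm (x + y) + sqnorm (x - y) = 2 * sqnorm x + 2 * sqnorm y.
  by rewrite /sqnorm !mxE; ring.
have qN x : sqnorm (- x) = sqnorm x by rewrite /sqnorm !mxE; ring.
(* With M = |V|^2, these give |c|^2 + |w|^2 <= M and |c|^2 + M <= |v|^2 = |w|^2, whose sum forces c
   = 0. The second one also yields M <= |w|^2 at the end. *)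
have := par c w; have := par c V.
rewrite -[c - V]opprB qN (_ : c + V = - (- V - c)) ?qN; last first.
  by rewrite opprB opprK.
move=> e1 e2.
have c0 : sqnorm c <= 0 by lra.
have {c0} c0 : c = 0.
  have := sqr_ge0 (c 0 0); have := sqr_ge0 (c 1 0) => p1 p0.
  have /eqP z0 : c 0 0 ^+ 2 = 0 by rewrite /sqnorm in c0; lra.
  have /eqP z1 : c 1 0 ^+ 2 = 0 by rewrite /sqnorm in c0; lra.
  by move: z0 z1; rewrite !sqrf_eq0 => /eqP z0 /eqP z1; apply: cV2_eq; rewrite mxE.
have wH : H0 d w by rewrite e -[w]add0r -c0 -hex_vertex_center; exact: hexagon_vertex.
have [_] := H0_sqnorm wH; apply.
have q0 : 0 <= sqnorm c by rewrite addr_ge0 ?sqr_ge0.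
by lra.
Qed.

End Hexagon.

(** * Translations between opposite sides, and the periodicity of u *)

(** The sides agree only as sets, so the images of the endpoints c + p and c + q are first placed at
    unknown parameters a and b on the segment from c - p to c - q. Subtracting the two images gives
    (1 + b - a)(p - q) = 0. *)
Lemma opposite_side_translation (R : realType) (c v t : 'cV[R]_2) (k : nat) :
  [set x + t | x in hex_side c v k] = hex_side c v (k + 3) ->
  t = - (hex_vertex 0 v k + hex_vertex 0 v k.+1).
Proof.
set p := hex_vertex 0 v k; set q := hex_vertex 0 v k.+1 => e.
have side x : hex_side c v k x ->
      exists2 a : R, 0 <= a <= 1 & x + t = c - p + a *: (p - q).
  move=> hx; have : hex_side c v (k + 3) (x + t) by rewrite -e; exists x.
  move=> /segment_point[a a01 ->]; exists a => //.
  rewrite -(addSn k 3) !(hex_vertex_center c) !hex_vertexD3 -/p -/q.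
  by apply: cV2_eq; rewrite !mxE; ring.
have [|a a01 ea] := side (c + p).
  by rewrite -hex_vertex_center; apply: sub_convex_hull; left.
have [|b b01 eb] := side (c + q).
  by rewrite -hex_vertex_center; apply: sub_convex_hull; right.
have te : t = (a *: (p - q)) - p - p.
  by apply: (addrI (c + p)); rewrite ea; apply: cV2_eq; rewrite !mxE; ring.
(* If p <> q then a = 1 + b with a, b in [0, 1], hence a = 1. *)
have : (1 + b - a) *: (p - q) = 0.
  apply: (addrI (c + q + t)); rewrite addr0 {2}eb te.
  by apply: cV2_eq; rewrite !mxE; ring.
move/eqP; rewrite scaler_eq0 !subr_eq0 => /orP[/eqP ab|/eqP pq]; last first.
  by rewrite te pq subrr scaler0 sub0r (opprD q).
have -> : t = (p - q) - p - p by rewrite te (_ : a = 1) ?scale1r //; lra.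
by apply: cV2_eq; rewrite !mxE; ring.
Qed.

(** The first conjunct ensures that the second one is not vacuous. *)
Theorem theorem2p3 (R : realType) (d : R) (u : 'cV[R]_2 -> R)
    (d_gt0 : 0 < d) (u_per : P0_periodic d u) (u_sym : D6_symmetric u) :
  regular_hexagon (H0 d) /\ hexagon_periodic (H0 d) u.
Proof.
split.
  exists 0, (H0_vertex d); split; last exact: H0_hexagon.
  apply/eqP => /(congr1 (fun x : 'cV[R]_2 => x 0 0)).
  by rewrite /H0_vertex !mxE /= => d0; lra.
move=> S S' t [c [v [k [_ eH -> ->]]]] /opposite_side_translation -> x.
have [l el] := hexagon_H0_vertex k d_gt0 eH.
have [m em] := hexagon_H0_vertex k.+1 d_gt0 eH.
(* Translating by both lattice vectors cancels t, the opposite of their sum. *)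
rewrite el em /lattice_vector -[LHS](u_per l) -[LHS](u_per m); congr u.
by apply: cV2_eq; rewrite ![in LHS]mxE; ring.
Qed.
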